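(* Let $(A_n)_{n\ge 0}$ be a sequence of complex numbers, and let $a,b,c,x\in\mathbb{C}$ with $c\notin\{0,-1,-2,\dots\}$. Then for all integers $1\le m\le n$ the Gauss-Appell polynomials satisfy the differential relations $$D_{x\hat\chi}^{m}\,[(x\hat\chi+\hat a)^{n}\phi_0\psi_0]=\frac{n!}{(n-m)!}\;{}_{{}_2F_1}A_{n-m}(a,b;c;x),$$ $$D_{\hat a}^{m}\,[(x\hat\chi+\hat a)^{n}\phi_0\psi_0]=\frac{n!}{(n-m)!}\;{}_{{}_2F_1}A_{n-m}(a,b;c;x).$$
   Context: $(r)_k=r(r+1)\cdots(r+k-1)$, $(r)_0=1$, is the Pochhammer symbol. Umbral convention: $X$ (written $x\hat\chi$) and $\hat a$ are commuting indeterminates. For a polynomial $Q(x\hat\chi,\hat a)\in\mathbb{C}[x\hat\chi,\hat a]$, the expression $Q\,\phi_0\psi_0$ denotes the complex number obtained by applying the linear functional determined by $(x\hat\chi)^k\hat a^j\,\phi_0\psi_0=x^k\frac{(a)_k(b)_k}{(c)_k}A_j$ for all $k,j\ge 0$. $D_{x\hat\chi}$ and $D_{\hat a}$ are the partial derivatives on $\mathbb{C}[x\hat\chi,\hat a]$ with respect to the indeterminates $x\hat\chi$ and $\hat a$. Such operators act on the polynomial in $x\hat\chi,\hat a$ before the functional is applied: $D[Q\,\phi_0\psi_0]$ means $(DQ)\,\phi_0\psi_0$. The Gauss-Appell polynomials associated with $(A_n)$ are defined for $n\ge 0$ by ${}_{{}_2F_1}A_n(a,b;c;x)=(x\hat\chi+\hat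 a)^n\phi_0\psi_0$, that is, ${}_{{}_2F_1}A_n(a,b;c;x)=\sum_{k=0}^{n}\binom{n}{k}\frac{(a)_k(b)_k}{(c)_k}x^kA_{n-k}$. *)

(* Defs.v *)
From HB Require Import structures.
From mathcomp Require Import all_boot all_order all_algebra.
From mathcomp Require Import reals.
From mathcomp Require Import complex.
From mathcomp.multinomials Require Import ssrcomplements mpoly.

Set Implicit Arguments.
Unset Strict Implicit.
Unset Printing Implicit Defensive.

Import GRing.Theory.
Local Open Scope ring_scope.

Definition pochhammer (K : pzRingType) (r : K) (k : nat) : K :=
  \prod_(i < k) (r + i%:R).

(* The umbral ring is {mpoly K[2]}. The product of the scalar x with the umbra
   chi is a single indeterminate, 'X_xchi; the scalar x enters only through
   the functional [umbral]. *)
Definition xchi : 'I_2 := ord0.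
Definition ahat : 'I_2 := ord_max.

Section Umbral.
Variable K : fieldType.
Implicit Types (A : nat -> K) (a b c x : K) (Q : {mpoly K[2]}).

Definition umbral_moment A a b c x (k j : nat) : K :=
  x ^+ k * (pochhammer a k * pochhammer b k / pochhammer c k) * A j.

(* The value of Q applied to the vacua phi_0 psi_0; [umbral_is_linear] and
   [umbralX] below characterize it. *)
Definition umbral A a b c x Q : K :=
  \sum_(m <- msupp Q) Q@_m * umbral_moment A a b c x (m xchi) (m ahat).

Definition gauss_appell A a b c x (n : nat) : K :=
  umbral A a b c x (('X_xchi + 'X_ahat) ^+ n).

Lemma umbralwE A a b c x k Q : (msize Q <= k)%N ->
  umbral A a b c x Q =
  \sum_(m : 'X_{1..2 < k}) Q@_m * umbral_moment A a b c x (m xchi) (m ahat).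
Proof.
pose I : subFinType _ := 'X_{1..2 < k}.
move=> le_Qk; rewrite /umbral (big_mksub I) /=; first last.
  by move=> m /msize_mdeg_lt/leq_trans/(_ le_Qk).
  by rewrite msupp_uniq.
rewrite big_rmcond //= => j /memN_msupp_eq0 ->.
by rewrite mul0r.
Qed.

Lemma umbral_is_linear A a b c x :
  linear (umbral A a b c x : {mpoly K[2]} -> K^o).
Proof.
move=> z P Q; set k := maxn (msize (z *: P + Q)) (maxn (msize P) (msize Q)).
have le1 : (msize (z *: P + Q) <= k)%N by rewrite leq_maxl.
have le2 : (msize P <= k)%N by rewrite !leq_max leqnn orbT.
have le3 : (msize Q <= k)%N by rewrite !leq_max leqnn !orbT.
rewrite (umbralwE _ _ _ _ _ le1) (umbralwE _ _ _ _ _ le2).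
rewrite (umbralwE _ _ _ _ _ le3) scaler_sumr -big_split /=.
by apply: eq_bigr => m _; rewrite mcoeffD mcoeffZ mulrDl -mulrA.
Qed.

HB.instance Definition _ A a b c x :=
  GRing.isLinear.Build K {mpoly K[2]} K^o _ (umbral A a b c x)
    (umbral_is_linear A a b c x).

Lemma umbralX A a b c x (k j : nat) :
  umbral A a b c x ('X_xchi ^+ k * 'X_ahat ^+ j) =
  x ^+ k * (pochhammer a k * pochhammer b k / pochhammer c k) * A j.
Proof.
rewrite !mpolyXn -mpolyXD /umbral msuppX big_seq1 mcoeffX eqxx mul1r.
by rewrite !mnmDE !mulmnE !mnm1E /= /umbral_moment !mul1n !mul0n addn0 add0n.
Qed.

Lemma gauss_appellE A a b c x (n : nat) :
  gauss_appell A a b c x n =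
  \sum_(k < n.+1) 'C(n, k)%:R *
    (pochhammer a k * pochhammer b k / pochhammer c k) * x ^+ k * A (n - k)%N.
Proof.
rewrite /gauss_appell addrC exprDn linear_sum; apply: eq_bigr => k _ /=.
rewrite linearMn /= mulrC umbralX -[LHS]mulr_natl -!mulrA; congr (_ * _).
by do 3![rewrite mulrCA; congr (_ * _)].
Qed.

End Umbral.

(* Main.v *)
Require Import Defs.
From mathcomp Require Import all_boot all_order all_algebra.
From mathcomp Require Import reals.
From mathcomp Require Import complex.
From mathcomp.multinomials Require Import mpoly.

Import GRing.Theory.
Local Open Scope ring_scope.

(** The base ['X_xchi + 'X_ahat] has derivative 1 in each of the two indeterminates, so either
    operator, applied m times to its n-th power, gives [n ^_ m] times the power n - m
    ([mderivn_exp]). The functional [umbral] is linear: the factor, which equals n!/(n - m)!, comes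
    out, and what remains is [gauss_appell] at n - m by definition. *)

Lemma mderivXU (K : nzRingType) (d : nat) (i j : 'I_d) :
  ('X_j : {mpoly K[d]})^`M(i) = (j == i)%:R.
Proof.
rewrite mderivX mnm1E; case: eqVneq => [->|_]; last by rewrite scale0r.
have -> : (U_(i) - U_(i) = 0)%MM by apply/mnmP => k; rewrite mnmBE subnn mnm0E.
by rewrite scale1r mpolyX0.
Qed.

(** By the Leibniz rule, a polynomial of derivative 1 is differentiated like a single variable. For
    m > n both sides are 0, since [n ^_ m] vanishes. *)
Lemma mderivn_exp (K : comNzRingType) (d : nat) (i : 'I_d) (p : {mpoly K[d]})
    (m n : nat) :
  p^`M(i) = 1 -> (p ^+ n)^`M(i, m) = p ^+ (n - m) *+ n ^_ m.
Proof.
move=> dp.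
have dpX k : (p ^+ k)^`M(i) = p ^+ k.-1 *+ k.
  elim: k => [|k IHk]; first by rewrite expr0 -mpolyC1 mderivC.
  rewrite exprS mderivM dp mul1r IHk mulrnAr mulrS.
  (* For k = 0 the truncated [k.-1] is harmless, its term having coefficient 0. *)
  by case: k {IHk} => [|k]; rewrite ?mulr0n //= exprS.
elim: m => [|m IHm]; first by rewrite mderivn0 subn0.
(* The new exponent factor n - m extends the falling factorial. *)
by rewrite mderivnS IHm mderivMn dpX -mulrnA mulnC -ffactnSr subnS.
Qed.

Theorem theorem3 (R : realType) (A : nat -> R[i]) (a b c x : R[i])
    (hc : forall k : nat, c <> - k%:R)
    (m n : nat) (hm : (1 <= m)%N) (hmn : (m <= n)%N) :
  umbral A a b c x ((('X_xchi + 'X_ahat) ^+ n)^`M(xchi, m)) =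
    n`!%:R / (n - m)`!%:R * gauss_appell A a b c x (n - m)
  /\
  umbral A a b c x ((('X_xchi + 'X_ahat) ^+ n)^`M(ahat, m)) =
    n`!%:R / (n - m)`!%:R * gauss_appell A a b c x (n - m).
Proof.
have ffactR : n`!%:R / (n - m)`!%:R = (n ^_ m)%:R :> R[i].
  (* Cancelling (n - m)! is legitimate in characteristic 0. *)
  by rewrite -(ffact_fact hmn) natrM mulfK // Num.Theory.pnatr_eq0 -lt0n fact_gt0.
have umbral_deriv (i : 'I_2) :
    ('X_xchi + 'X_ahat : {mpoly R[i][2]})^`M(i) = 1 ->
    umbral A a b c x ((('X_xchi + 'X_ahat) ^+ n)^`M(i, m)) =
      n`!%:R / (n - m)`!%:R * gauss_appell A a b c x (n - m).
  by move=> dX; rewrite mderivn_exp // linearMn ffactR mulr_natl.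
by split; apply: umbral_deriv; rewrite mderivD !mderivXU ?addr0 ?add0r.
Qed.
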